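(* Let $1<s<\infty$, $0<p<s$, $-n\left(1-\frac ps\right)<\alpha<n(p-1)$ and $\alpha\le0$. Suppose that a sublinear operator $H$ (acting on functions on $\mathbf{R}^n$) is bounded on $L^s$ and satisfies: (i) there is a constant $C$ such that $|Hf(x)|\le C\|f\|_{L^1}/|x-x_0|^n$ whenever $\operatorname{supp}f\subseteq B(x_0,2^k)$ and $|x-x_0|\ge2^{k+1}$, with $x_0\in\mathbf{R}^n$ and $k\in\mathbf{Z}$; (ii) $|Hf|\le\sum_j|\lambda_j||Ha_j|$ for every $f=\sum_j\lambda_ja_j\in BL^{p,s}_{|x|^\alpha}$, where each $a_j$ is a $(p,s,\alpha)$-block and $\sum_j|\lambda_j|^{\bar p}<\infty$. Then $H$ is of type $(BL^{p,s}_{|x|^\alpha},L^p_{|x|^\alpha})$; that is, there is a constant $C'$ such that $\|Hf\|_{L^p_{|x|^\alpha}}\le C'\|f\|_{BL^{p,s}_{|x|^\alpha}}$ for all $f\in BL^{p,s}_{|x|^\alpha}$.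
   Context: $H$ is assumed to be defined, with values in measurable functions, on $L^s(\mathbf{R}^n)$ and on $BL^{p,s}_{|x|^\alpha}$; sublinear means $|H(f+g)|\le|Hf|+|Hg|$ and $|H(cf)|=|c||Hf|$. Condition (i) concerns functions $f$ in the domain of $H$. $B(x_0,r)=\{x\in\mathbf{R}^n:|x-x_0|\le r\}$ and $|\cdot|$ is Lebesgue measure for sets. Also $\|g\|_{L^p_{|x|^\alpha}}=\left(\int_{\mathbf{R}^n}|g(x)|^p|x|^\alpha dx\right)^{1/p}$. Blocks: for $\alpha\in\mathbf{R}$, $0<p<\infty$, $0<s\le\infty$, a function $a$ on $\mathbf{R}^n$ is a $(p,s,\alpha)$-block if there is a ball $B(x_0,r)$ with $x_0\in\mathbf{R}^n$, $r>0$, such that $\operatorname{supp}a\subseteq B(x_0,r)$ and $\|a\|_{L^s}\le|B(x_0,r)|^{-\frac{\alpha}{pn}-\frac1p+\frac1s}$. Let $\bar p=\min\{p,1\}$. The space $BL^{p,s}_{|x|^\alpha}$ consists of all $f=\sum_{k}\lambda_ka_k$ (countable sum, convergence a.e.), where each $a_k$ is a $(p,s,\alpha)$-block and $\sum_k|\lambda_k|^{\bar p}<\infty$, with quasinorm $\|f\|_{BL^{p,s}_{|x|^\alpha}}=\inf\left(\sum_k|\lambda_k|^{\bar p}\right)^{1/\bar p}$, the infimum over all such decompositions. *)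

(* Defs.v *)
From HB Require Import structures.
From mathcomp Require Import all_boot all_order all_algebra.
From mathcomp Require Import all_classical all_reals all_analysis.

Set Implicit Arguments.
Unset Strict Implicit.
Unset Printing Implicit Defensive.
Import Order.TTheory GRing.Theory Num.Theory.
Import numFieldNormedType.Exports.

Local Open Scope classical_set_scope.
Local Open Scope ring_scope.

(* R^n is [n.-tuple R] with the product Borel sigma-algebra of the library;
   its Lebesgue measure is built by induction on n, transporting the product
   measure along the bijection R * R^n -> R^(n+1). *)
Section lebesgue_measure_Rn.
Context {R : realType}.
Local Open Scope ereal_scope.

Definition consRn n (x : R * n.-tuple R) : n.+1.-tuple R :=
  [the n.+1.-tuple R of x.1 :: x.2].

Lemma measurable_consRn n : measurable_fun setT (@consRn n).
Proof. exact: measurable_cons. Qed.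

Section succ.
Variables (n : nat) (m : {sigma_finite_measure set (n.-tuple R) -> \bar R}).

Definition lebesgue_succ : set (n.+1.-tuple R) -> \bar R :=
  pushforward (@lebesgue_measure R \x m) (@consRn n).

Let lebesgue_succ0 : lebesgue_succ set0 = 0.
Proof. by rewrite /lebesgue_succ /pushforward preimage_set0 measure0. Qed.

Let lebesgue_succ_ge0 A : 0 <= lebesgue_succ A.
Proof. by rewrite /lebesgue_succ /pushforward measure_ge0. Qed.

Let lebesgue_succ_sigma_additive : semi_sigma_additive lebesgue_succ.
Proof.
move=> F mF tF mUF; rewrite /lebesgue_succ /pushforward preimage_bigcup.
apply: measure_semi_sigma_additive.
- by move=> i; rewrite -[X in measurable X]setTI; exact: measurable_consRn.
- apply/trivIsetP => /= i j _ _ ij; rewrite -preimage_setI.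
  by move/trivIsetP : tF => /(_ _ _ _ _ ij) ->//; rewrite preimage_set0.
- rewrite -preimage_bigcup -[X in measurable X]setTI.
  exact: measurable_consRn.
Qed.

HB.instance Definition _ := isMeasure.Build _ _ _ lebesgue_succ
  lebesgue_succ0 lebesgue_succ_ge0 lebesgue_succ_sigma_additive.

Let lebesgue_succ_sigma_finite : sigma_finite setT lebesgue_succ.
Proof.
have /sigma_finiteP[F [TF ndF Foo]] := sigma_finiteT (@lebesgue_measure R).
have /sigma_finiteP[G [TG ndG Goo]] := sigma_finiteT m.
pose g (t : n.+1.-tuple R) : R * n.-tuple R := (thead t, [tuple of behead t]).
have mg : measurable_fun setT g.
  by apply/measurable_fun_pair;
    [exact: measurable_tnth|exact: measurable_behead].
have gK x : g (consRn x) = x.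
  by case: x => a t; congr pair; apply/val_inj.
exists (fun i => g @^-1` (F i `*` G i)).
  rewrite -preimage_bigcup (_ : \bigcup_i _ = setT) ?preimage_setT//.
  rewrite -setXTT TF TG predeqE => -[x y]; split.
    by move=> [i _ []/= ? ?]; split; exists i.
  move=> [/= [i _ Fix] [k _ Gky]]; exists (maxn i k) => //; split.
  - by move: x Fix; exact/subsetPset/ndF/leq_maxl.
  - by move: y Gky; exact/subsetPset/ndG/leq_maxr.
move=> i; have [mF Fi] := Foo i; have [mG Gi] := Goo i; split.
  by rewrite -[X in measurable X]setTI; apply: mg => //; exact: measurableX.
rewrite /lebesgue_succ /pushforward -comp_preimage (_ : g \o _ = id); last first.
  by apply/funext => x /=; rewrite gK.
by rewrite preimage_id product_measure1E// lte_mul_pinfty// ge0_fin_numE.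
Qed.

HB.instance Definition _ := Measure_isSigmaFinite.Build _ _ _ lebesgue_succ
  lebesgue_succ_sigma_finite.

End succ.

Fixpoint lebesgueRn n : {sigma_finite_measure set (n.-tuple R) -> \bar R} :=
  match n with
  | 0%N => \d_([tuple] : 0.-tuple R)
  | n'.+1 => lebesgue_succ (lebesgueRn n')
  end.

Lemma lebesgueRn_box n (A : 'I_n -> set R) : (forall i, measurable (A i)) ->
  lebesgueRn n [set x | forall i, A i (tnth x i)] =
  \prod_(i < n) lebesgue_measure (A i).
Proof.
elim: n A => [A _|n IH A mA] /=.
  by rewrite big_ord0 diracE mem_set//= => -[].
rewrite big_ord_recl -IH; last by move=> i; exact: mA.
rewrite /lebesgue_succ /pushforward -product_measure1E//; last first.
  rewrite (_ : [set x | _] =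
    \bigcap_(i in [set: 'I_n]) ((@tnth n R)^~ i @^-1` A (lift ord0 i))).
    apply: fin_bigcap_measurable; first exact: finite_finset.
    move=> i _; rewrite -[X in measurable X]setTI.
    by apply: measurable_tnth => //; exact: mA.
  by apply/seteqP; split=> x /= h i; [move=> _; exact: h|exact: (h i I)].
  exact: mA.
apply: (congr1 (product_measure1 _ _)).
apply/seteqP; split=> -[a t] /=.
  move=> h; split; first by have := h ord0; rewrite (tnth_nth 0%R).
  by move=> i; have := h (lift ord0 i); rewrite tnthS.
move=> [Aa At] i; case: (unliftP ord0 i) => [j ->|->].
  by rewrite tnthS.
by rewrite (tnth_nth 0%R).
Qed.

End lebesgue_measure_Rn.

Section euclidean.
Context {R : realType} {n : nat}.
Implicit Types (x y : n.-tuple R) (r : R).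

Definition enorm x : R := Num.sqrt (\sum_(i < n) tnth x i ^+ 2).

Definition edist x y : R :=
  Num.sqrt (\sum_(i < n) (tnth x i - tnth y i) ^+ 2).

Definition cball x r : set (n.-tuple R) := [set y | edist y x <= r].

Definition supp (f : n.-tuple R -> R) : set (n.-tuple R) :=
  [set x | forall e, 0 < e -> exists2 y, edist y x < e & f y != 0].

End euclidean.

Section block_spaces.
Context {R : realType} {n : nat}.
Notation T := (n.-tuple R).
Notation mu := (@lebesgueRn R n).
Implicit Types (f g : T -> R) (p alpha : R) (s : \bar R).

(* The convention 0 `^ alpha = 0 (alpha != 0) only concerns the null set {0}. *)
Definition weighted_Lnorm p alpha g : \bar R :=
  ((\int[mu]_x (`|g x| `^ p * enorm x `^ alpha)%:E) `^ p^-1)%E.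

(* [s] is extended: [fine s^-1] is 1/s, and 0 for s = +oo. *)
Definition block p s alpha (a : T -> R) : Prop :=
  measurable_fun setT a /\
  exists x0 r, [/\ 0 < r, supp a `<=` cball x0 r &
    ('N[mu]_s[EFin \o a] <=
     mu (cball x0 r) `^ (- (alpha / (p * n%:R)) - p^-1 + fine s^-1))%E].

Definition pbar p : R := Num.min p 1.

(* Finite sums are included: 0 is a block, and coefficients may vanish. *)
Definition block_decomp p s alpha f (lam : R^nat) (a : nat -> T -> R) : Prop :=
  [/\ measurable_fun setT f,
      forall k, block p s alpha (a k),
      (\sum_(k <oo) (`|lam k| `^ pbar p)%:E < +oo)%E &
      {ae mu, forall x, series (fun k => lam k * a k x) @ \oo --> f x}].

Definition BL p s alpha : set (T -> R) :=
  [set f | exists lam a, block_decomp p s alpha f lam a].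

Definition BLnorm p s alpha f : \bar R :=
  ereal_inf [set v | exists lam a, block_decomp p s alpha f lam a /\
    v = ((\sum_(k <oo) (`|lam k| `^ pbar p)%:E) `^ (pbar p)^-1)%E].

(* The domain of the operators: the union of L^s and BL. *)
Definition opdom p s alpha : set (T -> R) :=
  [set f | f \in Lfun mu s] `|` BL p s alpha.

(* The values of an operator outside [D] are irrelevant; pointwise relations
   between measurable functions are understood almost everywhere. *)
Definition measurable_valued (D : set (T -> R)) (H : (T -> R) -> T -> R) :=
  forall f, D f -> measurable_fun setT (H f).

Definition sublinear (D : set (T -> R)) (H : (T -> R) -> T -> R) : Prop :=
  (forall f g, D f -> D g -> D (f \+ g) ->
     {ae mu, forall x, `|H (f \+ g) x| <= `|H f x| + `|H g x|}) /\
  (forall c f, D f -> D (c \*o f) ->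
     {ae mu, forall x, `|H (c \*o f) x| = `|c| * `|H f x|}).

Definition bounded_on_Lp s (H : (T -> R) -> T -> R) : Prop :=
  exists C : R, forall f, f \in Lfun mu s ->
    ('N[mu]_s[EFin \o H f] <= C%:E * 'N[mu]_s[EFin \o f])%E.

(* [0 < C] keeps the bound trivial when the L^1 norm is infinite (0 * +oo = 0). *)
Definition size_condition (D : set (T -> R)) (H : (T -> R) -> T -> R) : Prop :=
  exists2 C : R, 0 < C &
    forall f (x0 : T) (k : int), D f -> supp f `<=` cball x0 (2 ^ k) ->
    {ae mu, forall x, 2 ^ (k + 1) <= edist x x0 ->
      (`|H f x|%:E <= C%:E * 'N[mu]_1[EFin \o f] * (edist x x0 ^- n)%:E)%E}.

Definition countably_sublinear p s alpha (H : (T -> R) -> T -> R) : Prop :=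
  forall f lam a, block_decomp p s alpha f lam a ->
    {ae mu, forall x,
      (`|H f x|%:E <= \sum_(k <oo) (`|lam k| * `|H (a k) x|)%:E)%E}.

Definition type_BL_L p s alpha (H : (T -> R) -> T -> R) : Prop :=
  exists C : R, forall f, BL p s alpha f ->
    (weighted_Lnorm p alpha (H f) <= C%:E * BLnorm p s alpha f)%E.

End block_spaces.

(* Main.v *)
Require Import Defs.
From HB Require Import structures.
From mathcomp Require Import all_boot all_order all_algebra.
From mathcomp Require Import all_classical all_reals all_analysis.
From mathcomp Require Import measurable_realfun ring lra.

Import Order.TTheory GRing.Theory Num.Theory.
Import numFieldNormedType.Exports.
Import Defs.

Local Open Scope classical_set_scope.
Local Open Scope ring_scope.

Set Implicit Arguments.
Unset Strict Implicit.
Unset Printing Implicit Defensive.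

(** The weight [|x|^alpha] has [-n < alpha <= 0], so its integral over a ball of
radius [r] is at most a constant times [r^(n + alpha)], wherever the ball lies
([integral_weight_cball]). The normalisation of a block [a] carried by
[B(x0, r)] is tuned to this growth, and gives a bound on the weighted [L^p]
norm of [H a] that depends neither on [r] nor on [x0]
([block_image_bound]):

- on a ball of radius comparable to [r], Hoelder's inequality with exponents
  [s/p] and [q := (s/p)' = (1 - p/s)^-1] plays the [L^s] bound of [H] against
  the integral of [|x|^(alpha q)] ([local_bound]). This is where
  [-n (1 - p/s) < alpha] enters: it says [-n < alpha q];
- far from [x0], the size condition makes [|H a|] at most a constant times
  [||a||_1 |x - x0|^-n]. On the shell where [|x - x0|] is about [2^j r], the
  integral of [|x - x0|^(-n p) |x|^alpha] is at most a constant times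
  [(2^j r)^(n + alpha - n p)], and these form a summable geometric progression
  exactly when [alpha < n (p - 1)] ([far_bound]).

In both regions the powers of [r] cancel.

It remains to pass from blocks to [f = sum_k lambda_k a_k]. From
[|H f| <= sum_k |lambda_k| |H a_k|] and the elementary inequality
[(sum_k l_k g_k)^p <= (sum_k l_k^pb)^(p/pb - 1) sum_k l_k^pb g_k^p], where
[pb = min(p, 1)] ([nneseries_powR_le]: subadditivity of the power when
[p <= 1], Hoelder's inequality for series when [p > 1]), one integrates term by
term. Since the integrals of [|H a_k|^p |x|^alpha] are bounded uniformly in
[k], this replaces the triangle inequality in the weighted [L^p] space and
treats quasinorms and norms at once ([superposition_bound]). Taking the
infimum over the decompositions of [f] concludes. *)

(** * Dyadic scales *)

Section dyadic_scales.
Context {R : realType}.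

Lemma dyadic_bracket_ge1 (t : R) :
  1 <= t -> exists j : nat, 2 ^+ j <= t /\ t < 2 ^+ j.+1.
Proof.
move=> t1.
have ex : exists j : nat, t < 2 ^+ j.
  exists (Num.truncn t).+1; apply: (lt_trans (truncnS_gt t)).
  by rewrite -natrX ltr_nat ltn_expl.
case: (ex_minnP ex) => -[|j] tj jmin.
  by move: tj; rewrite expr0 ltNge t1.
exists j; split => //; rewrite leNgt; apply/negP => /jmin.
by rewrite ltnn.
Qed.

Lemma dyadic_bracket_le1 (t : R) :
  0 < t -> t <= 1 -> exists j : nat, 2 ^- j.+1 <= t /\ t <= 2 ^- j.
Proof.
move=> t0 t1.
have [|j [j1 j2]] := @dyadic_bracket_ge1 t^-1; first by rewrite invf_ge1.
exists j; rewrite -[t]invrK !lef_pV2 ?posrE ?invr_gt0 ?exprn_gt0//.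
by split => //; exact: ltW.
Qed.

Lemma exists_dyadic_radius (r : R) :
  0 < r -> exists k : int, r <= 2 ^ k /\ 2 ^ k <= 2 * r.
Proof.
move=> r0; have [r1|/ltW r1] := leP 1 r.
  have [j [j1 j2]] := dyadic_bracket_ge1 r1.
  exists j.+1; rewrite -exprnP; split; first exact: ltW.
  by rewrite exprS ler_pM2l.
have [j [j1 j2]] := dyadic_bracket_le1 r0 r1.
exists (- j%:Z); rewrite -exprnN; split => //.
by move: j1; rewrite exprS invfM ler_pdivrMl.
Qed.

End dyadic_scales.

(** * Powers of real numbers *)

Section powers.
Context {R : realType}.
Implicit Types a b t : R.

Lemma powR_expR a b : expR a `^ b = expR (a * b).
Proof. by rewrite expRM. Qed.

Lemma expR_exprn a (k : nat) : expR a ^+ k = expR (a * k%:R).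
Proof. by rewrite mulrC expRM_natl. Qed.

(** Writing every positive quantity as an exponential turns an identity between
products of powers into a linear identity between exponents, which [ring] and
[field] decide. *)
Lemma gt0_expR a : 0 < a -> exists b, a = expR b.
Proof. by move=> a0; exists (ln a); rewrite lnK. Qed.

Lemma ler_powR_npos a b t : 0 < a -> a <= b -> t <= 0 -> b `^ t <= a `^ t.
Proof.
move=> a0 ab t0; have b0 : 0 < b by exact: lt_le_trans ab.
rewrite -[t]opprK !(powRN _ (- t)) lef_pV2 ?posrE ?powR_gt0//.
by rewrite ge0_ler_powR ?nnegrE ?oppr_ge0 ?(ltW a0) ?(ltW b0).
Qed.

(** The exponent may have either sign, hence the sum of the two endpoint values
instead of one of them. *)
Lemma powR_bracket a b c t : 0 < a -> a <= c -> c <= b ->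
  c `^ t <= a `^ t + b `^ t.
Proof.
move=> a0 ac cb; have c0 : 0 < c by exact: lt_le_trans ac.
have [t0|/ltW t0] := leP 0 t.
  apply: (@le_trans _ _ (b `^ t)); last by rewrite lerDr powR_ge0.
  by rewrite ge0_ler_powR ?nnegrE ?(ltW c0) ?(le_trans (ltW c0) cb).
apply: (@le_trans _ _ (a `^ t)); last by rewrite lerDl powR_ge0.
exact: ler_powR_npos.
Qed.

End powers.

(** * Integral estimates *)

Section integration.
Context d (T : measurableType d) (R : realType).
Variable mu : {measure set T -> \bar R}.

(** Dyadic decomposition without a partition: it is enough that each point be
served by one of the dominating functions, for then their sum dominates, and
the shells may be replaced by nested balls, whose measure is easier to bound. *)
Lemma le_integral_geometric (D : set T) (f : T -> \bar R)
    (g : nat -> T -> \bar R) (b z : R) :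
  measurable D -> measurable_fun D f -> (forall x, D x -> 0 <= f x)%E ->
  (forall j, measurable_fun D (g j)) ->
  (forall j x, D x -> 0 <= g j x)%E ->
  (forall x, D x -> exists j, (f x <= g j x)%E) ->
  0 <= z < 1 ->
  (forall j, \int[mu]_(x in D) g j x <= (b * z ^+ j)%:E)%E ->
  (\int[mu]_(x in D) f x <= (b / (1 - z))%:E)%E.
Proof.
move=> mD mf f0 mg g0 fg /andP[z0 z1] gb.
have mG : measurable_fun D (fun x => \sum_(0 <= j <oo) g j x)%E.
  by apply: ge0_emeasurable_sum => // k x Dx _; exact: g0.
apply: (@le_trans _ _ (\int[mu]_(x in D) (\sum_(0 <= j <oo) g j x))%E).
  apply: ge0_le_integral => // x Dx; have [j /le_trans] := fg _ Dx; apply.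
  apply: (le_trans _ (nneseries_lim_ge j.+1 _)) => [|k _ _]; last exact: g0.
  rewrite big_nat_recr//= leeDr// sume_ge0// => i _; exact: g0.
rewrite integral_nneseries//.
have ig0 j : (0 <= \int[mu]_(x in D) g j x)%E.
  by apply: integral_ge0 => x; exact: g0.
apply: lime_le; first by apply: is_cvg_nneseries => j _ _; exact: ig0.
apply: nearW => k.
apply: (@le_trans _ _ (\sum_(0 <= j < k) (b * z ^+ j)%:E)%E).
  by apply: lee_sum => j _; exact: gb.
have b0 : 0 <= b.
  by have := le_trans (ig0 0%N) (gb 0%N); rewrite lee_fin expr0 mulr1.
rewrite sumEFin lee_fin.
have /(congr1 (fun u => u k)) := @geometric_seriesE R b z (negbT (lt_eqF z1)).
rewrite /series /geometric /= => ->.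
rewrite ler_wpM2r ?invr_ge0 ?subr_ge0 ?(ltW z1)//.
by rewrite ler_piMr// lerBlDr lerDl exprn_ge0.
Qed.

Lemma le_integral_indic (D B : set T) (f : T -> R) :
  measurable D -> measurable B -> measurable_fun setT f ->
  (forall x, 0 <= f x) ->
  (\int[mu]_(x in D) (f x * \1_B x)%:E <= \int[mu]_(x in B) (f x)%:E)%E.
Proof.
move=> mD mB mf f0.
apply: (@le_trans _ _ (\int[mu]_x (f x * \1_B x)%:E)%E).
  apply: ge0_subset_integral => //.
    apply/measurable_EFinP; apply: measurable_funM => //.
  by move=> x _; rewrite lee_fin mulr_ge0.
rewrite [leRHS]integral_mkcond le_eqVlt; apply/orP; left; apply/eqP.
apply: eq_integral => x _; rewrite /patch indicE.
by case: ifP; rewrite ?mulr1 ?mulr0.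
Qed.

(** The exponent [s / p] turns [|f|^p] back into the [L^s] norm of [f]; its
conjugate [(1 - p / s)^-1] falls on the weight. *)
Lemma hoelder_weight (f w : T -> R) (B : set T) (p s : R) :
  measurable_fun setT f -> measurable_fun setT w -> (forall x, 0 <= w x) ->
  measurable B -> 0 < p -> p < s ->
  (\int[mu]_(x in B) (`|f x| `^ p * w x)%:E <=
   'N[mu]_s%:E[EFin \o f] `^ p *
   (\int[mu]_(x in B) (w x `^ (1 - p / s)^-1)%:E) `^ (1 - p / s))%E.
Proof.
move=> mf mw w0 mB p0 ps; have s0 : 0 < s by exact: lt_trans ps.
have e0 : 0 < 1 - p / s by rewrite subr_gt0 ltr_pdivrMr// mul1r.
have sp0 : 0 < s / p by rewrite divr_gt0.
have mF : measurable_fun setT (fun x => `|f x| `^ p).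
  by apply: (measurableT_comp (measurable_powR _)); exact: measurableT_comp.
have mG : measurable_fun setT (fun x => w x * \1_B x).
  by apply: measurable_funM => //; exact: measurable_indic.
have := @hoelder _ _ _ mu _ _ (s / p) (1 - p / s)^-1 mF mG sp0.
rewrite invr_gt0 e0 => /(_ isT).
rewrite invf_div invrK subrKC => /(_ erefl); rewrite Lnorm1.
rewrite (_ : (\int[mu]_x _)%E = (\int[mu]_(x in B) (`|f x| `^ p * w x)%:E)%E).
  move/le_trans; apply; rewrite le_eqVlt; apply/orP; left; apply/eqP.
  rewrite unlock /Lnorm invf_div invrK; congr (_ * _)%E.
    rewrite -[RHS]poweRrM [s^-1 * p]mulrC; congr (_ `^ _)%E.
    apply: eq_integral => x _ /=.
    rewrite ger0_norm ?powR_ge0// -powRrM; congr (_ `^ _)%:E.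
    by field; rewrite gt_eqF.
  congr (_ `^ _)%E; rewrite [RHS]integral_mkcond; apply: eq_integral => x _ /=.
  rewrite /patch indicE; case: ifP => _; first by rewrite mulr1 ger0_norm.
  by rewrite mulr0 normr0 powR0// invr_eq0 gt_eqF.
rewrite [RHS]integral_mkcond; apply: eq_integral => x _ /=.
rewrite /patch indicE; case: ifP => _; last by rewrite !mulr0 normr0.
by rewrite mulr1 ger0_norm// mulr_ge0// powR_ge0.
Qed.

End integration.

(** * Measure of Euclidean balls *)

Section balls.
Context {R : realType} {n : nat}.
Notation T := (n.-tuple R).
Notation mu := (@lebesgueRn R n).
Implicit Types (x y : T) (r : R).

Lemma measurable_edist x0 : measurable_fun setT (fun x : T => edist x x0).
Proof.
have -> : (fun x : T => edist x x0) =
    (fun x => (\sum_(i < n) (tnth x i - tnth x0 i) ^+ 2) `^ 2^-1).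
  by apply/funext => x; rewrite powR12_sqrt// sumr_ge0// => i _; exact: sqr_ge0.
apply: (measurableT_comp (measurable_powR _)).
apply: measurable_sum => i.
apply: measurable_funX; apply: measurable_funB => //.
exact: measurable_tnth.
Qed.

Definition origin : T := [tuple of nseq n 0].

Lemma edist_origin x : edist x origin = enorm x.
Proof.
rewrite /edist /enorm; congr Num.sqrt; apply: eq_bigr => i _.
by rewrite tnth_nseq subr0.
Qed.

Lemma measurable_enorm : measurable_fun setT (@enorm R n).
Proof.
by rewrite (_ : enorm = edist^~ origin);
  [exact: measurable_edist | apply/funext => x; rewrite edist_origin].
Qed.

Lemma measurable_cball x0 r : measurable (cball x0 r).
Proof.
rewrite (_ : cball _ _ = (fun x : T => edist x x0) @^-1` `]-oo, r]).
  by rewrite -[X in measurable X]setTI; exact: measurable_edist.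
by apply/seteqP; split => x /=; rewrite in_itv.
Qed.

Lemma lebesgueRn_cube x0 r : 0 <= r ->
  mu [set x : T | forall i,
    `[tnth x0 i - r, tnth x0 i + r]%classic (tnth x i)] =
  ((2 * r) ^+ n)%:E.
Proof.
move=> r0.
rewrite (lebesgueRn_box (A := fun i => `[tnth x0 i - r, tnth x0 i + r]%classic))//.
rewrite (eq_bigr (fun=> (2 * r)%:E)).
  by rewrite prodEFin big_const_ord iter_mulr_1.
move=> i _; rewrite lebesgue_measure_itv/= lte_fin.
case: ltP => h; first by rewrite -EFinB; congr EFin; ring.
have -> : r = 0 by lra.
by rewrite mulr0.
Qed.

Lemma measurable_cube x0 r :
  measurable [set x : T | forall i,
    `[tnth x0 i - r, tnth x0 i + r]%classic (tnth x i)].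
Proof.
rewrite (_ : [set x | _] = \bigcap_(i in [set: 'I_n])
  ((@tnth n R)^~ i @^-1` `[tnth x0 i - r, tnth x0 i + r]%classic)).
  apply: fin_bigcap_measurable; first exact: finite_finset.
  by move=> i _; rewrite -[X in measurable X]setTI; exact: measurable_tnth.
by apply/seteqP; split=> x /= h i; [move=> _; exact: h|exact: (h i I)].
Qed.

(** A ball of radius [r] lies between the cubes of half-sides [r / n] and [r];
hence its volume is of order [r^n], which is all that scaling requires. *)
Lemma cball_measure_le x0 r : 0 <= r ->
  (mu (cball x0 r) <= ((2 * r) ^+ n)%:E)%E.
Proof.
move=> r0; rewrite -(lebesgueRn_cube x0 r0).
apply: le_measure; rewrite ?inE; [exact: measurable_cball|exact: measurable_cube|].
move=> x /=; rewrite /cball/= => xr i; rewrite in_itv/=.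
suff : `|tnth x i - tnth x0 i| <= r by rewrite ler_norml => /andP[]; lra.
apply: le_trans xr; rewrite -sqrtr_sqr ler_wsqrtr//.
by rewrite (bigD1 i)//= lerDl sumr_ge0// => j _; exact: sqr_ge0.
Qed.

Lemma cball_measure_ge x0 r : (0 < n)%N -> 0 <= r ->
  (((2 * (r / n%:R)) ^+ n)%:E <= mu (cball x0 r))%E.
Proof.
move=> n0 r0.
have n0' : (0 : R) < n%:R by rewrite ltr0n.
have rn0 : 0 <= r / n%:R by rewrite divr_ge0.
rewrite -(lebesgueRn_cube x0 rn0).
apply: le_measure; rewrite ?inE; [exact: measurable_cube|exact: measurable_cball|].
move=> x /= xr; rewrite /cball/= -[leRHS]ger0_norm// -sqrtr_sqr ler_wsqrtr//.
apply: (@le_trans _ _ (\sum_(i < n) (r / n%:R) ^+ 2)).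
  apply: ler_sum => i _; have := xr i; rewrite in_itv/= => /andP[h1 h2].
  by rewrite -real_normK ?num_real// lerXn2r ?nnegrE// ler_norml; lra.
rewrite sumr_const card_ord expr_div_n -[leLHS]mulr_natr.
rewrite -mulrA ler_piMr ?sqr_ge0// expr2 invfM -mulrA mulVf ?gt_eqF// mulr1.
by rewrite invf_le1// ler1n.
Qed.

End balls.

(** * Power weights on balls and on complements of balls *)

Section weights.
Context {R : realType} {n : nat}.
Notation T := (n.-tuple R).
Notation mu := (@lebesgueRn R n).

Lemma enorm_ge0 (x : T) : 0 <= enorm x.
Proof. exact: sqrtr_ge0. Qed.

Lemma edist_ge0 (x y : T) : 0 <= edist x y.
Proof. exact: sqrtr_ge0. Qed.

Lemma measurable_weight (b : R) :
  measurable_fun setT (fun x : T => enorm x `^ b).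
Proof. exact: measurableT_comp (measurable_powR _) measurable_enorm. Qed.

Lemma cball_measure_powR (n0 : (0 < n)%N) (t : R) : exists2 C : R, 0 < C &
  forall (x0 : T) r, 0 < r ->
    (mu (cball x0 r) `^ t <= (C * r `^ (n%:R * t))%:E)%E.
Proof.
have n0' : (0 : R) < n%:R by rewrite ltr0n.
exists (((2 / n%:R) ^+ n) `^ t + (2 ^+ n) `^ t) => [|x0 r r0].
  by rewrite ltr_wpDl ?powR_ge0// powR_gt0// exprn_gt0.
have := cball_measure_le x0 (ltW r0); have := cball_measure_ge x0 n0 (ltW r0).
have : (0 <= mu (cball x0 r))%E by exact: measure_ge0.
move: (mu (cball x0 r)) => [m| |]//= _; rewrite !lee_fin => m1 m2.
rewrite (_ : _ `^ (n%:R * t) = (r ^+ n) `^ t); last first.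
  by rewrite powRrM powR_mulrn// ltW.
rewrite mulrDl -!powRM ?exprn_ge0 ?divr_ge0 ?(ltW r0)//.
rewrite -!exprMn; apply: powR_bracket => //.
  by rewrite exprn_gt0// mulr_gt0// divr_gt0.
by move: m1; rewrite mulrA mulrAC.
Qed.

(** The shell [2^-(j+1) rho <= |x| <= 2^-j rho] contributes at most a constant
times [(2^-j rho)^b (2^-j rho)^n], a geometric progression of ratio
[2^-(n + b) < 1]. *)
Lemma integral_weight_origin (b : R) : - n%:R < b -> b <= 0 ->
  exists2 C : R, 0 < C & forall rho, 0 < rho ->
    (\int[mu]_(x in cball origin rho) (enorm x `^ b)%:E <=
     (C * rho `^ (n%:R + b))%:E)%E.
Proof.
move=> nb b0; have nb0 : 0 < n%:R + b by rewrite -ltrBlDl sub0r.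
have z1 : (2 : R) `^ (- (n%:R + b)) < 1.
  have [l El] : exists l : R, 2 = expR l by exact: gt0_expR.
  have l0 : 0 < l by rewrite -expR_gt1 -El ltr1n.
  by rewrite El powR_expR expR_lt1 mulrN oppr_lt0 mulr_gt0.
exists (2 ^+ n * 2 `^ (- b) / (1 - 2 `^ (- (n%:R + b)))) => [|rho rho0].
  by rewrite divr_gt0 ?subr_gt0// mulr_gt0 ?exprn_gt0// powR_gt0.
pose g (j : nat) (x : T) : \bar R :=
  ((2 ^- j.+1 * rho) `^ b * \1_(cball origin (2 ^- j * rho)) x)%:E.
rewrite mulrAC; apply: (@le_integral_geometric _ _ _ _ _ _ g).
- exact: measurable_cball.
- apply: measurable_funTS; apply/measurable_EFinP; exact: measurable_weight.
- by move=> x _; rewrite lee_fin powR_ge0.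
- move=> j; apply: measurable_funTS; apply/measurable_EFinP.
  apply: measurable_funM => //; exact: measurable_indic (measurable_cball _ _).
- by move=> j x _; rewrite lee_fin mulr_ge0 ?powR_ge0.
- move=> x; rewrite /cball/= edist_origin => xr.
  (* The origin lies in no shell; there the weight is 0, or 1 if b = 0, and the
     term j = 0 dominates it in both cases. *)
  have [x0|x0] := eqVneq (enorm x) 0.
    exists 0%N; rewrite /g x0 lee_fin indicE mem_set; last first.
      by rewrite /cball/= edist_origin x0 mulr_ge0// ltW.
    rewrite mulr1; have [->|bn0] := eqVneq b 0; first by rewrite !powRr0.
    by rewrite powR0// powR_ge0.
  have xp : 0 < enorm x by rewrite lt0r x0 enorm_ge0.
  have [||j [j1 j2]] := @dyadic_bracket_le1 R (enorm x / rho).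
  + by rewrite divr_gt0.
  + by rewrite ler_pdivrMr// mul1r.
  exists j; rewrite /g lee_fin indicE mem_set; last first.
    by rewrite /cball/= edist_origin -ler_pdivrMr.
  rewrite mulr1; apply: ler_powR_npos => //; last by rewrite -ler_pdivlMr.
  by rewrite mulr_gt0// invr_gt0 exprn_gt0.
- by rewrite powR_ge0.
- move=> j; rewrite /g.
  apply: (le_trans (le_integral_indic _ _ (measurable_cball _ _) _ _)) => //.
  + exact: measurable_cball.
  + by move=> _; exact: powR_ge0.
  rewrite (integral_cst mu (measurable_cball _ _)).
  have rj : 0 < 2 ^- j * rho by rewrite mulr_gt0// invr_gt0 exprn_gt0.
  apply: (@le_trans _ _
    (((2 ^- j.+1 * rho) `^ b)%:E * ((2 * (2 ^- j * rho)) ^+ n)%:E)%E).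
    apply: lee_wpmul2l; first by rewrite lee_fin powR_ge0.
    by apply: cball_measure_le; exact: ltW.
  rewrite -EFinM lee_fin le_eqVlt; apply/orP; left; apply/eqP.
  have [l ->] : exists l : R, 2 = expR l by exact: gt0_expR.
  have [k ->] := gt0_expR rho0.
  rewrite !(expR_exprn, =^~ expRN, =^~ expRD, powR_expR).
  by congr expR; ring.
Qed.

(** As [b <= 0], the weight is at most [rho^b] outside [B(0, rho)], so the
position of the centre does not matter: the part of the ball inside [B(0, rho)]
is covered by the centred estimate, the rest by the volume. *)
Lemma integral_weight_cball (b : R) : - n%:R < b -> b <= 0 ->
  exists2 C : R, 0 < C & forall x0 rho, 0 < rho ->
    (\int[mu]_(x in cball x0 rho) (enorm x `^ b)%:E <=
     (C * rho `^ (n%:R + b))%:E)%E.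
Proof.
move=> nb b0; have [C C0 HC] := integral_weight_origin nb b0.
exists (C + 2 ^+ n) => [|x0 rho rho0]; first by rewrite addr_gt0// exprn_gt0.
pose B : set T := cball x0 rho; pose B0 : set T := cball origin rho.
have mB : measurable B by exact: measurable_cball.
have mB0 : measurable B0 by exact: measurable_cball.
have mw (D : set T) : measurable_fun D (fun x : T => (enorm x `^ b)%:E).
  by apply: measurable_funTS; apply/measurable_EFinP; exact: measurable_weight.
have w0 (x : T) : (0 <= (enorm x `^ b)%:E)%E by rewrite lee_fin powR_ge0.
rewrite -/B -(setUIDK B B0) ge0_integral_setU//; last 3 first.
- exact: measurableI.
- exact: measurableD.
- by apply/disj_setPS => x [[_ ?] [_]].
rewrite mulrDl EFinD; apply: leeD.
  apply: le_trans (HC _ rho0).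
  by apply: ge0_subset_integral => //; exact: measurableI.
apply: (@le_trans _ _ (\int[mu]_(x in B `\` B0) (rho `^ b)%:E)%E).
  apply: ge0_le_integral => //; first exact: measurableD.
  move=> x [_]; rewrite /B0/cball/= edist_origin => /negP; rewrite -ltNge => xr.
  by rewrite lee_fin ler_powR_npos// ltW.
rewrite (integral_cst mu (measurableD mB mB0)).
apply: (@le_trans _ _ ((rho `^ b)%:E * ((2 * rho) ^+ n)%:E)%E).
  apply: lee_wpmul2l; first by rewrite lee_fin powR_ge0.
  apply: le_trans (cball_measure_le x0 (ltW rho0)).
  by apply: le_measure; rewrite ?inE//; exact: measurableD.
rewrite -EFinM lee_fin le_eqVlt; apply/orP; left; apply/eqP.
have [l ->] : exists l : R, 2 = expR l by exact: gt0_expR.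
have [k ->] := gt0_expR rho0.
rewrite !(expR_exprn, =^~ expRN, =^~ expRD, powR_expR).
by congr expR; ring.
Qed.

Definition far (x0 : T) (r : R) : set T := [set x | r <= edist x x0].

Lemma measurable_far x0 r : measurable (far x0 r).
Proof.
rewrite (_ : far _ _ = (fun x : T => edist x x0) @^-1` `[r, +oo[).
  by rewrite -[X in measurable X]setTI; exact: measurable_edist.
by apply/seteqP; split => x /=; rewrite in_itv/= andbT.
Qed.

(** Shells [2^j (2 rho) <= |x - x0| < 2^(j+1) (2 rho)], each bounded by the
integral of the weight over the larger ball; the ratio of the progression is
[2^(n + b - q)]. *)
Lemma integral_weight_far (q b : R) :
  - n%:R < b -> b <= 0 -> n%:R + b < q ->
  exists2 C : R, 0 < C & forall x0 rho, 0 < rho ->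
    (\int[mu]_(x in far x0 (2 * rho)) (edist x x0 `^ (- q) * enorm x `^ b)%:E <=
     (C * rho `^ (n%:R + b - q))%:E)%E.
Proof.
move=> nb b0 bq; have [C C0 HC] := integral_weight_cball nb b0.
have q0 : 0 < q by apply: lt_trans bq; rewrite -ltrBlDl sub0r.
have z1 : (2 : R) `^ (n%:R + b - q) < 1.
  have [l El] : exists l : R, 2 = expR l by exact: gt0_expR.
  have l0 : 0 < l by rewrite -expR_gt1 -El ltr1n.
  by rewrite El powR_expR expR_lt1 nmulr_llt0// subr_lt0.
exists (C * 2 `^ (- q) * 4 `^ (n%:R + b) / (1 - 2 `^ (n%:R + b - q)))
    => [|x0 rho rho0].
  by rewrite divr_gt0 ?subr_gt0// !mulr_gt0 ?powR_gt0.
pose r (j : nat) := 2 ^+ j * (2 * rho).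
have r0 j : 0 < r j by rewrite !mulr_gt0// exprn_gt0.
pose g (j : nat) (x : T) : \bar R :=
  (r j `^ (- q) * enorm x `^ b * \1_(cball x0 (r j.+1)) x)%:E.
have md : measurable_fun setT (fun x : T => edist x x0 `^ (- q)).
  exact: measurableT_comp (measurable_powR _) (measurable_edist x0).
rewrite mulrAC; apply: (@le_integral_geometric _ _ _ _ _ _ g).
- exact: measurable_far.
- apply: measurable_funTS; apply/measurable_EFinP.
  by apply: measurable_funM => //; exact: measurable_weight.
- by move=> x _; rewrite lee_fin mulr_ge0 ?powR_ge0.
- move=> j; apply: measurable_funTS; apply/measurable_EFinP.
  apply: measurable_funM => //.
    by apply: measurable_funM => //; exact: measurable_weight.
  exact: measurable_indic (measurable_cball _ _).
- by move=> j x _; rewrite lee_fin !mulr_ge0 ?powR_ge0.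
- move=> x; rewrite /far/= => xr.
  have [|j [j1 j2]] := @dyadic_bracket_ge1 R (edist x x0 / (2 * rho)).
    by rewrite ler_pdivlMr ?mul1r// mulr_gt0.
  exists j; rewrite /g lee_fin indicE mem_set; last first.
    by rewrite /cball/= -ler_pdivrMr ?mulr_gt0// ltW.
  rewrite mulr1 ler_wpM2r ?powR_ge0//; apply: ler_powR_npos => //.
    by rewrite -ler_pdivlMr// mulr_gt0.
  by rewrite oppr_le0 ltW.
- by rewrite powR_ge0.
- move=> j; rewrite /g.
  apply: (le_trans (le_integral_indic _ _ (measurable_cball _ _) _ _)) => //.
  + exact: measurable_far.
  + by apply: measurable_funM => //; exact: measurable_weight.
  + by move=> x; rewrite mulr_ge0 ?powR_ge0.
  under eq_integral do rewrite EFinM.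
  rewrite ge0_integralZl//; last 4 first.
  + exact: measurable_cball.
  + by apply: measurable_funTS; apply/measurable_EFinP; exact: measurable_weight.
  + by move=> x _; rewrite lee_fin powR_ge0.
  + by rewrite lee_fin powR_ge0.
  apply: (le_trans (lee_wpmul2l _ (HC _ _ (r0 _)))).
    by rewrite lee_fin powR_ge0.
  rewrite -EFinM lee_fin /r le_eqVlt; apply/orP; left; apply/eqP.
  have -> : (4 : R) = 2 * 2 by ring.
  have [l ->] : exists l : R, 2 = expR l by exact: gt0_expR.
  have [k ->] := gt0_expR rho0.
  have [c ->] := gt0_expR C0.
  rewrite !(expR_exprn, =^~ expRN, =^~ expRD, powR_expR).
  by congr expR; ring.
Qed.

End weights.

(** * Blocks *)

Section blocks.
Context {R : realType} {n : nat}.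
Notation T := (n.-tuple R).
Notation mu := (@lebesgueRn R n).

Lemma supp_outside_eq0 (f : T -> R) (B : set T) x :
  supp f `<=` B -> ~ B x -> f x = 0.
Proof.
move=> fB nBx; apply/eqP; apply: contra_notT nBx => fx0; apply: fB.
move=> e e0; exists x => //; rewrite /edist big1 ?sqrtr0// => i _.
by rewrite subrr expr0n.
Qed.

(** The case [p = 1] and [w = 1] of [hoelder_weight]. *)
Lemma Lnorm1_supp_le (f : T -> R) (x0 : T) (r s : R) :
  measurable_fun setT f -> supp f `<=` cball x0 r -> 1 < s ->
  ('N[mu]_1[EFin \o f] <=
   'N[mu]_s%:E[EFin \o f] * mu (cball x0 r) `^ (1 - s^-1))%E.
Proof.
move=> mf fB s1; have mB := @measurable_cball R n x0 r.
have := @hoelder_weight _ _ _ mu f (cst 1) _ 1 s mf (measurable_cst _)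
  (fun=> ler01) mB ltr01 s1.
rewrite div1r poweRe1 ?Lnorm_ge0//; congr (_ <= _)%E.
  rewrite Lnorm1 [LHS]integral_mkcond; apply: eq_integral => x _ /=.
  rewrite /patch mulr1 powRr1//; case: ifPn => // /negP xB.
  by rewrite (supp_outside_eq0 fB) ?normr0// => Bx; apply: xB; rewrite inE.
congr (_ * _ `^ _)%E; under eq_integral do rewrite /= powR1.
by rewrite (integral_cst mu mB) mul1e.
Qed.

Lemma block_Lfun (p s alpha : R) (a : T -> R) : 0 < s ->
  block p s%:E alpha a -> a \in Lfun mu s%:E.
Proof.
move=> s0 [ma [x0 [r [r0 _ aN]]]]; rewrite inE; apply/andP; split.
  by rewrite inE.
rewrite inE /finLfun/= /finite_norm (le_lt_trans aN)// poweR_lty//.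
by apply: le_lt_trans (cball_measure_le _ (ltW r0)) _; rewrite ltry.
Qed.

End blocks.

(** * Uniform bound for the image of a block *)

Section local_and_far.
Context {R : realType} {n : nat} (p s alpha : R).
Hypotheses (n0 : (0 < n)%N) (s1 : 1 < s) (p0 : 0 < p) (ps : p < s).
Hypotheses (alpha_gt : - (n%:R * (1 - p / s)) < alpha).
Hypotheses (alpha_lt : alpha < n%:R * (p - 1)) (alpha_le0 : alpha <= 0).
Notation T := (n.-tuple R).
Notation mu := (@lebesgueRn R n).

Let n0R : (0 : R) < n%:R. Proof. by rewrite ltr0n. Qed.
Let s0 : 0 < s. Proof. exact: lt_trans s1. Qed.
Let e0 : 0 < 1 - p / s.
Proof. by rewrite subr_gt0 ltr_pdivrMr// mul1r. Qed.

Let alpha_gtn : - n%:R < alpha.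
Proof.
apply: le_lt_trans alpha_gt; rewrite lerN2 ler_piMr ?ltW//.
by rewrite ltrBlDr ltrDl divr_gt0.
Qed.

(** The powers of the volume in the definition of a block become powers of the
radius; the [L^1] bound follows from the [L^s] one by Hoelder's inequality on
the ball. *)
Lemma block_norms : exists2 C : R, 0 < C & forall a : T -> R,
  block p s%:E alpha a -> exists x0 r, [/\ 0 < r, supp a `<=` cball x0 r,
    ('N[mu]_s%:E[EFin \o a] <=
      (C * r `^ (n%:R / s - n%:R / p - alpha / p))%:E)%E &
    ('N[mu]_1[EFin \o a] <= (C * r `^ (n%:R - n%:R / p - alpha / p))%:E)%E].
Proof.
pose theta := - (alpha / (p * n%:R)) - p^-1 + s^-1.
have [C1 C10 HC1] := @cball_measure_powR R n n0 theta.
have [C2 C20 HC2] := @cball_measure_powR R n n0 (1 - s^-1).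
exists (C1 + C1 * C2) => [|a [ma [x0 [r [r0 suppa aN]]]]].
  by rewrite addr_gt0// mulr_gt0.
have {}aN : ('N[mu]_s%:E[EFin \o a] <=
    (C1 * r `^ (n%:R / s - n%:R / p - alpha / p))%:E)%E.
  move: aN; rewrite inver gt_eqF//= -/theta => /le_trans; apply.
  apply: (le_trans (HC1 x0 r r0)); rewrite lee_fin le_eqVlt.
  apply/orP; left; apply/eqP; congr (_ * _ `^ _); rewrite /theta.
  by field; rewrite !gt_eqF.
exists x0, r; split => //.
  apply: (le_trans aN); rewrite lee_fin ler_wpM2r ?powR_ge0// lerDl.
  by rewrite mulr_ge0// ltW.
apply: (le_trans (Lnorm1_supp_le ma suppa s1)).
apply: (@le_trans _ _ ((C1 * r `^ (n%:R / s - n%:R / p - alpha / p))%:E *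
    (C2 * r `^ (n%:R * (1 - s^-1)))%:E)%E).
  by apply: lee_pmul => //; [exact: Lnorm_ge0|exact: poweR_ge0|exact: HC2].
rewrite -EFinM lee_fin mulrACA -powRD; last first.
  by apply/implyP => _; rewrite gt_eqF.
rewrite (_ : _ + _ * _ = n%:R - n%:R / p - alpha / p); last first.
  by field; rewrite !gt_eqF.
by rewrite ler_wpM2r ?powR_ge0// lerDr ltW.
Qed.

(** Hoelder's inequality; [(n + alpha q) / q = n (1 - p / s) + alpha]. *)
Lemma local_bound : exists2 K : R, 0 < K & forall (f : T -> R) x0 r N,
  measurable_fun setT f -> 0 < r -> 0 <= N ->
  ('N[mu]_s%:E[EFin \o f] <= N%:E)%E ->
  (\int[mu]_(x in cball x0 r) (`|f x| `^ p * enorm x `^ alpha)%:E <=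
   (K * N `^ p * r `^ (n%:R * (1 - p / s) + alpha))%:E)%E.
Proof.
pose q := (1 - p / s)^-1.
have nq : - n%:R < alpha * q.
  by rewrite /q ltr_pdivlMr// mulNr.
have q0 : alpha * q <= 0 by rewrite mulr_le0_ge0// invr_ge0 ltW.
have [C C0 HC] := integral_weight_cball nq q0.
exists (C `^ (1 - p / s)) => [|f x0 r N mf r0 N0 fN]; first exact: powR_gt0.
apply: (le_trans (hoelder_weight mu mf (@measurable_weight R n alpha)
  (fun=> powR_ge0 _ _) (@measurable_cball R n x0 r) p0 ps)).
apply: (@le_trans _ _ (N%:E `^ p *
    (C * r `^ (n%:R + alpha * q))%:E `^ (1 - p / s))%E).
  apply: lee_pmul; rewrite ?poweR_ge0//; apply: gt0_ler_poweR => //.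
  - exact: ltW.
  - by rewrite in_itv/= Lnorm_ge0 leey.
  - by rewrite in_itv/= lee_fin N0 leey.
  - exact: ltW.
  - rewrite in_itv/= leey andbT; apply: integral_ge0 => x _.
    by rewrite lee_fin powR_ge0.
  - by rewrite in_itv/= lee_fin mulr_ge0 ?powR_ge0 ?(ltW C0)//= leey.
  - by under eq_integral do rewrite -powRrM; exact: HC.
rewrite !poweR_EFin -EFinM lee_fin (powRM _ (ltW C0) (powR_ge0 _ _)) -powRrM.
rewrite (_ : (_ + _) * _ = n%:R * (1 - p / s) + alpha).
  by rewrite mulrA [N `^ _ * _]mulrC.
by rewrite mulrDl /q divfK ?gt_eqF.
Qed.

(** The hypothesis [alpha < n (p - 1)] reads [n + alpha < n p], which is what
makes [|x - x0|^(- n p) |x|^alpha] integrable at infinity. *)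
Lemma far_bound : exists2 K : R, 0 < K & forall (f : T -> R) x0 r M,
  measurable_fun setT f -> 0 < r -> 0 <= M ->
  {ae mu, forall x, 2 * r <= edist x x0 -> `|f x| <= M * edist x x0 ^- n} ->
  (\int[mu]_(x in far x0 (2 * r)) (`|f x| `^ p * enorm x `^ alpha)%:E <=
   (K * M `^ p * r `^ (n%:R + alpha - n%:R * p))%:E)%E.
Proof.
have np : n%:R + alpha < n%:R * p by move: alpha_lt; rewrite mulrBr mulr1; lra.
have [K K0 HK] := integral_weight_far alpha_gtn alpha_le0 np.
exists K => // f x0 r M mf r0 M0 fM.
have md : measurable_fun setT (fun x : T => edist x x0 `^ (- (n%:R * p))).
  exact: measurableT_comp (measurable_powR _) (measurable_edist x0).
have mdw : measurable_fun (far x0 (2 * r))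
    (fun x : T => (edist x x0 `^ (- (n%:R * p)) * enorm x `^ alpha)%:E).
  apply: measurable_funTS; apply/measurable_EFinP.
  by apply: measurable_funM => //; exact: measurable_weight.
apply: (@le_trans _ _ (\int[mu]_(x in far x0 (2 * r))
    ((M `^ p)%:E * (edist x x0 `^ (- (n%:R * p)) * enorm x `^ alpha)%:E)%E)%E).
  apply: ae_ge0_le_integral => //.
  - exact: measurable_far.
  - by move=> x _; rewrite lee_fin mulr_ge0 ?powR_ge0.
  - apply: measurable_funTS; apply/measurable_EFinP.
    apply: measurable_funM; last exact: measurable_weight.
    by apply: (measurableT_comp (measurable_powR _)); exact: measurableT_comp.
  - by move=> x _; rewrite -EFinM lee_fin !mulr_ge0 ?powR_ge0.
  - by apply: emeasurable_funM.
  apply: filterS fM => x fMx Dx.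
  rewrite -EFinM lee_fin mulrA ler_wpM2r ?powR_ge0//.
  have {}fMx := fMx Dx.
  rewrite -mulNr powRrM powR_invn ?edist_ge0// -powRM ?invr_ge0 ?exprn_ge0 ?edist_ge0//.
  by rewrite ge0_ler_powR ?nnegrE ?(ltW p0)// (le_trans _ fMx).
rewrite ge0_integralZl//; last 3 first.
- exact: measurable_far.
- by move=> x _; rewrite lee_fin mulr_ge0 ?powR_ge0.
- by rewrite lee_fin powR_ge0.
apply: (le_trans (lee_wpmul2l _ (HK x0 r r0))); first by rewrite lee_fin powR_ge0.
by rewrite -EFinM lee_fin mulrA [M `^ _ * _]mulrC.
Qed.

(** The radius [r] of a block is replaced by a dyadic [rho] with
[r <= rho <= 2 r], as the size condition only concerns dyadic balls. The split
is at [2 rho]: the local part scales as [r] to the power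
[p (n/s - n/p - alpha/p) + n (1 - p/s) + alpha = 0], the far part as [r] to the
power [p (n - n/p - alpha/p) + n + alpha - n p = 0]. *)
Lemma block_image_bound (H : (T -> R) -> T -> R) :
  measurable_valued (opdom p s%:E alpha) H ->
  bounded_on_Lp s%:E H ->
  size_condition (opdom p s%:E alpha) H ->
  exists2 K : R, 0 < K & forall a : T -> R, block p s%:E alpha a ->
    (\int[mu]_x (`|H a x| `^ p * enorm x `^ alpha)%:E <= K%:E)%E.
Proof.
move=> mH [A HA] [S S0 HS].
have [C C0 HC] := block_norms.
have [K1 K10 HK1] := local_bound; have [K2 K20 HK2] := far_bound.
(* The given constant of the L^s bound may fail to be positive. *)
pose A' := Num.max A 1.
have A'0 : 0 < A' by rewrite lt_max ltr01 orbT.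
have ex1 : 0 <= n%:R * (1 - p / s) + alpha by rewrite ltW// -ltrBlDl sub0r.
have ex2 : n%:R + alpha - n%:R * p <= 0.
  by move: alpha_lt; rewrite mulrBr mulr1; lra.
exists (K1 * (A' * C) `^ p * 4 `^ (n%:R * (1 - p / s) + alpha) +
        K2 * (S * C) `^ p) => [|a blocka].
  by rewrite addr_gt0// !mulr_gt0 ?powR_gt0// mulr_gt0.
have aLs := block_Lfun s0 blocka.
have Da : opdom p s%:E alpha a by left.
have mHa := mH _ Da.
have [x0 [r [r0 suppa aNs aN1]]] := HC _ blocka.
have [k [rk kr]] := exists_dyadic_radius r0.
set rho : R := 2 ^ k in rk kr *.
have rho0 : 0 < rho by exact: lt_le_trans rk.
have HaNs : ('N[mu]_s%:E[EFin \o H a] <=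
    (A' * (C * r `^ (n%:R / s - n%:R / p - alpha / p)))%:E)%E.
  apply: (le_trans (HA _ aLs)); rewrite EFinM; apply: (@le_trans _ _ (A'%:E *
    'N[mu]_s%:E[EFin \o a])%E).
    by apply: lee_wpmul2r; [exact: Lnorm_ge0|rewrite lee_fin le_max lexx].
  by apply: lee_wpmul2l => //; rewrite lee_fin ltW.
have Hafar : {ae mu, forall x, 2 * rho <= edist x x0 ->
    `|H a x| <= S * (C * r `^ (n%:R - n%:R / p - alpha / p)) *
      edist x x0 ^- n}.
  have suppk : supp a `<=` cball x0 (2 ^ k).
    by apply: (subset_trans suppa) => x; rewrite /cball/= => /le_trans; apply.
  apply: filterS (HS a x0 k Da suppk) => x + xr.
  rewrite exprzDr ?unitfE ?pnatr_eq0// expr1z mulrC -/rho => /(_ xr) h.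
  rewrite -lee_fin; apply: (le_trans h); rewrite 2!EFinM.
  apply: lee_wpmul2r; first by rewrite lee_fin invr_ge0 exprn_ge0// edist_ge0.
  by apply: lee_wpmul2l => //; rewrite lee_fin ltW.
have mI (D : set T) : measurable_fun D
    (fun x => (`|H a x| `^ p * enorm x `^ alpha)%:E).
  apply: measurable_funTS; apply/measurable_EFinP.
  apply: measurable_funM; last exact: measurable_weight.
  by apply: (measurableT_comp (measurable_powR _)); exact: measurableT_comp.
have I0 x : (0 <= (`|H a x| `^ p * enorm x `^ alpha)%:E)%E.
  by rewrite lee_fin mulr_ge0 ?powR_ge0.
have mB : measurable (cball x0 (2 * rho)) by exact: measurable_cball.
rewrite -(setUv (cball x0 (2 * rho))) ge0_integral_setU//; last 2 first.
- exact: measurableC.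
- by apply/disj_setPCl.
have rho20 : 0 < 2 * rho by exact: mulr_gt0.
have CN0 : 0 <= A' * (C * r `^ (n%:R / s - n%:R / p - alpha / p)).
  by rewrite !mulr_ge0 ?powR_ge0// ltW.
have SN0 : 0 <= S * (C * r `^ (n%:R - n%:R / p - alpha / p)).
  by rewrite !mulr_ge0 ?powR_ge0// ltW.
rewrite EFinD; apply: leeD.
  apply: (le_trans (HK1 _ x0 _ _ mHa rho20 CN0 HaNs)); rewrite lee_fin.
  apply: (@le_trans _ _ (K1 *
    (A' * (C * r `^ (n%:R / s - n%:R / p - alpha / p))) `^ p *
    (4 * r) `^ (n%:R * (1 - p / s) + alpha))).
    apply: ler_wpM2l; first by rewrite mulr_ge0 ?powR_ge0// ltW.
    by rewrite ge0_ler_powR ?nnegrE ?mulr_ge0 ?(ltW r0) ?(ltW rho0)//; lra.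
  have [c ->] := gt0_expR r0; have [c' ->] := gt0_expR C0.
  have [a' ->] := gt0_expR A'0; have [k1 ->] := gt0_expR K10.
  have [l ->] : exists l : R, 4 = expR l by exact: gt0_expR.
  rewrite !(=^~ expRD, powR_expR) ler_expR le_eqVlt; apply/orP; left; apply/eqP.
  by field; rewrite !gt_eqF.
apply: (@le_trans _ _ (\int[mu]_(x in far x0 (2 * rho))
    (`|H a x| `^ p * enorm x `^ alpha)%:E)%E).
  apply: ge0_subset_integral => //; first exact: measurableC.
    exact: measurable_far.
  by move=> x; rewrite /far/cball/= => /negP; rewrite -ltNge => /ltW.
apply: (le_trans (HK2 _ x0 _ _ mHa rho0 SN0 Hafar)); rewrite lee_fin.
apply: (@le_trans _ _ (K2 *
  (S * (C * r `^ (n%:R - n%:R / p - alpha / p))) `^ p *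
  r `^ (n%:R + alpha - n%:R * p))).
  apply: ler_wpM2l; first by rewrite mulr_ge0 ?powR_ge0// ltW.
  exact: ler_powR_npos.
have [c ->] := gt0_expR r0; have [c' ->] := gt0_expR C0.
have [a' ->] := gt0_expR S0; have [k1 ->] := gt0_expR K20.
rewrite !(=^~ expRD, powR_expR) ler_expR le_eqVlt; apply/orP; left; apply/eqP.
by field; rewrite !gt_eqF.
Qed.

End local_and_far.

(** * Powers of series *)

Section sums.
Context {R : realType}.
Implicit Types (p a b : R).

(** [a = a^p a^(1-p)] is at most [a^p (a + b)^(1-p)]; likewise for [b], and the
two inequalities add up. *)
Lemma powR_subadditive p a b : 0 < p -> p <= 1 -> 0 <= a -> 0 <= b ->
  (a + b) `^ p <= a `^ p + b `^ p.
Proof.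
move=> p0 p1 a0 b0.
have H c d : 0 <= c -> 0 <= d -> c * (c + d) `^ (p - 1) <= c `^ p.
  rewrite le_eqVlt => /predU1P[<- _|c0 d0]; first by rewrite mul0r powR_ge0.
  rewrite -(mulr_powRB1 (ltW c0) p0); apply: ler_wpM2l; first exact: ltW.
  by apply: ler_powR_npos => //; rewrite ?lerDl// subr_le0.
rewrite -mulr_powRB1 ?addr_ge0// mulrDl; apply: lerD; first exact: H.
by rewrite [X in X `^ _]addrC; exact: H.
Qed.

(** The sum of the [u k] may be infinite although all terms are real, so the
inequality is first proved for partial sums and the limit is taken after
extracting [p]-th roots, the right-hand side being then fixed. *)
Lemma nneseries_le_powR p (u : nat -> R) : 0 < p -> p <= 1 ->
  (forall k, 0 <= u k) ->
  ((\sum_(k <oo) (u k)%:E) `^ p <= \sum_(k <oo) (u k `^ p)%:E)%E.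
Proof.
move=> p0 p1 u0.
have u0E k : (0 <= (u k)%:E)%E by rewrite lee_fin.
have up0 k : (0 <= (u k `^ p)%:E)%E by rewrite lee_fin powR_ge0.
have S0 : (0 <= \sum_(k <oo) (u k `^ p)%:E)%E by apply: nneseries_ge0.
have le_partial N : ((\sum_(0 <= k < N) u k) `^ p <=
    \sum_(0 <= k < N) u k `^ p)%R.
  elim: N => [|N ih]; first by rewrite !big_geq// powR0// gt_eqF.
  rewrite !big_nat_recr//=; apply: le_trans (lerD ih (lexx _)).
  by apply: powR_subadditive => //; exact: sumr_ge0.
have -> : (\sum_(k <oo) (u k `^ p)%:E =
    (\sum_(k <oo) (u k `^ p)%:E) `^ p^-1 `^ p)%E.
  by rewrite -poweRrM mulVf ?gt_eqF// poweRe1.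
apply: gt0_ler_poweR; first exact: ltW.
- by rewrite in_itv/= leey andbT; apply: nneseries_ge0.
- by rewrite in_itv/= leey andbT poweR_ge0.
apply: lime_le; first by apply: is_cvg_nneseries.
apply: nearW => N; rewrite sumEFin.
have -> : ((\sum_(0 <= k < N) u k)%:E =
    ((\sum_(0 <= k < N) u k) `^ p)%:E `^ p^-1)%E.
  by rewrite poweR_EFin -powRrM mulfV ?gt_eqF// powRr1// sumr_ge0.
apply: gt0_ler_poweR; first by rewrite invr_ge0 ltW.
- by rewrite in_itv/= leey andbT lee_fin powR_ge0.
- by rewrite in_itv/= leey andbT.
apply: le_trans (nneseries_lim_ge N _) => //.
by rewrite sumEFin lee_fin.
Qed.

(** Hoelder's inequality for the counting measure and the factorisation
[l g = (l^(1/p) g) l^(1 - 1/p)]. *)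
Lemma nneseries_hoelder p (l g : nat -> R) : 1 < p ->
  (forall k, 0 <= l k) -> (forall k, 0 <= g k) ->
  ((\sum_(k <oo) (l k * g k)%:E) `^ p <=
   (\sum_(k <oo) (l k)%:E) `^ (p - 1) * \sum_(k <oo) (l k * g k `^ p)%:E)%E.
Proof.
move=> p1 l0 g0; have p0 : 0 < p by exact: lt_trans p1.
have q0 : 0 < 1 - p^-1 by rewrite subr_gt0 invf_lt1.
pose F k := l k `^ p^-1 * g k; pose G k := l k `^ (1 - p^-1).
have F0 k : 0 <= F k by rewrite mulr_ge0 ?powR_ge0.
have mF : measurable_fun setT F by [].
have mG : measurable_fun setT G by [].
have := @hoelder _ _ _ (@counting nat R) F G p (1 - p^-1)^-1 mF mG p0.
rewrite invr_gt0 invrK => /(_ q0) /(_ (subrKC _ _)).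
rewrite !Lnorm_counting ?invr_gt0// invr1 invrK.
have S0 (h : nat -> R) : (forall k, 0 <= h k) -> (0 <= \sum_(k <oo) (h k)%:E)%E.
  by move=> h0; apply: nneseries_ge0 => k _ _; rewrite lee_fin.
rewrite (eq_eseriesr (g := fun k => (l k * g k)%:E)); last first.
  move=> k _; rewrite /= powRr1// ger0_norm; last by rewrite mulr_ge0// powR_ge0.
  rewrite /F /G mulrAC -powRD; last by rewrite subrKC oner_eq0.
  by rewrite subrKC powRr1.
rewrite [X in (_ <= X `^ _ * _)%E](eq_eseriesr (g := fun k => (l k * g k `^ p)%:E)).
  rewrite [X in (_ <= _ * X `^ _)%E](eq_eseriesr (g := fun k => (l k)%:E)).
    rewrite poweRe1; last by apply: S0 => k; rewrite mulr_ge0.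
    set S := (\sum_(k <oo) (l k * g k `^ p)%:E)%E; set L := (\sum_(k <oo) (l k)%:E)%E.
    have SE0 : (0 <= S)%E by apply: S0 => k; rewrite mulr_ge0 ?powR_ge0.
    move=> h; apply: (@le_trans _ _ ((S `^ p^-1 * L `^ (1 - p^-1)) `^ p)%E).
      apply: gt0_ler_poweR => //; first exact: ltW.
        by rewrite in_itv/= leey andbT; apply: S0 => k; rewrite mulr_ge0.
      by rewrite in_itv/= leey andbT mule_ge0 ?poweR_ge0.
    rewrite poweRM ?poweR_ge0// -!poweRrM mulVf ?gt_eqF// poweRe1// muleC.
    by rewrite mulrBl mul1r mulVf ?gt_eqF.
  move=> k _; rewrite /= /G ger0_norm ?powR_ge0// -powRrM mulfV ?gt_eqF//.
  by rewrite powRr1.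
move=> k _; rewrite /= ger0_norm// /F powRM ?powR_ge0// -powRrM mulVf ?gt_eqF//.
by rewrite powRr1.
Qed.

Lemma pbar_gt0 p : 0 < p -> 0 < pbar p.
Proof. by move=> p0; rewrite lt_min p0 ltr01. Qed.

(** One formula for two regimes: the exponent of the first factor is [0] when
[p <= 1] and [p - 1] when [p > 1]. *)
Lemma nneseries_powR_le p (l g : nat -> R) : 0 < p ->
  (forall k, 0 <= l k) -> (forall k, 0 <= g k) ->
  ((\sum_(k <oo) (l k * g k)%:E) `^ p <=
   (\sum_(k <oo) (l k `^ pbar p)%:E) `^ (p / pbar p - 1) *
   \sum_(k <oo) (l k `^ pbar p * g k `^ p)%:E)%E.
Proof.
move=> p0 l0 g0; have [p1|p1] := leP p 1.
  rewrite /pbar min_l// divff ?gt_eqF// subrr poweRe0 mul1e.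
  apply: le_trans (nneseries_le_powR _ _ _) _ => //.
    by move=> k; rewrite mulr_ge0.
  by under eq_eseriesr do rewrite powRM//.
rewrite /pbar min_r ?(ltW p1)// divr1.
rewrite (eq_eseriesr (f := fun k => (l k `^ 1)%:E) (g := fun k => (l k)%:E)).
  rewrite [X in (_ <= _ * X)%E](eq_eseriesr (g := fun k => (l k * g k `^ p)%:E)).
    exact: nneseries_hoelder.
  by move=> k _; rewrite powRr1.
by move=> k _; rewrite powRr1.
Qed.

End sums.

(** * Superposition of blocks *)

Section superposition.
Context {R : realType} {n : nat}.
Notation T := (n.-tuple R).
Notation mu := (@lebesgueRn R n).

(** Raised to the power [1/p], the right-hand side is [K^(1/p)] times the
quantity whose infimum defines the quasinorm of the block space. *)
Lemma superposition_bound (p K : R) (w f : T -> R) (l : nat -> R)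
    (g : nat -> T -> R) :
  0 < p -> 0 <= K -> measurable_fun setT w -> (forall x, 0 <= w x) ->
  measurable_fun setT f -> (forall k, measurable_fun setT (g k)) ->
  (\sum_(k <oo) (`|l k| `^ pbar p)%:E < +oo)%E ->
  {ae mu, forall x, (`|f x|%:E <= \sum_(k <oo) (`|l k| * `|g k x|)%:E)%E} ->
  (forall k, \int[mu]_x (`|g k x| `^ p * w x)%:E <= K%:E)%E ->
  (\int[mu]_x (`|f x| `^ p * w x)%:E <=
   K%:E * (\sum_(k <oo) (`|l k| `^ pbar p)%:E) `^ (p / pbar p))%E.
Proof.
move=> p0 K0 mw w0 mf mg; have pb0 := pbar_gt0 p0.
have l0 k : (0 <= (`|l k| `^ pbar p)%:E)%E by rewrite lee_fin powR_ge0.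
have mgp (h : T -> R) : measurable_fun setT h ->
    measurable_fun setT (fun x => (`|h x| `^ p * w x)%:E).
  move=> mh; apply/measurable_EFinP; apply: measurable_funM => //.
  by apply: (measurableT_comp (measurable_powR _)); exact: measurableT_comp.
have hpw0 (h : T -> R) x : (0 <= (`|h x| `^ p * w x)%:E)%E.
  by rewrite lee_fin mulr_ge0 ?powR_ge0.
have L0 : (0 <= \sum_(k <oo) (`|l k| `^ pbar p)%:E)%E by exact: nneseries_ge0.
case LE : (\sum_(k <oo) (`|l k| `^ pbar p)%:E)%E L0 => [L| |]// L0 _ fg gK.
rewrite lee_fin in L0.
pose e := p / pbar p - 1.
pose S x := (\sum_(k <oo) ((`|l k| `^ pbar p)%:E * (`|g k x| `^ p * w x)%:E))%E.
have S0 x : (0 <= S x)%E.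
  by apply: nneseries_ge0 => k _ _; rewrite mule_ge0.
have mlg k : measurable_fun setT
    (fun x => ((`|l k| `^ pbar p)%:E * (`|g k x| `^ p * w x)%:E)%E).
  by apply: emeasurable_funM => //; exact: mgp.
have mS : measurable_fun setT S.
  by apply: ge0_emeasurable_sum => // k x _ _; rewrite mule_ge0.
apply: (@le_trans _ _ (\int[mu]_x ((L `^ e)%:E * S x))%E).
  apply: ae_ge0_le_integral => //.
  - exact: mgp.
  - by move=> x _; rewrite mule_ge0// lee_fin powR_ge0.
  - exact: emeasurable_funM.
  apply: filterS fg => x fgx _.
  have : ((`|f x| `^ p)%:E <= (L `^ e)%:E *
      \sum_(k <oo) (`|l k| `^ pbar p * `|g k x| `^ p)%:E)%E.
    rewrite -!poweR_EFin -LE; apply: le_trans (nneseries_powR_le p0 _ _) => //.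
    apply: gt0_ler_poweR => //; first exact: ltW.
      by rewrite in_itv/= leey andbT lee_fin.
    rewrite in_itv/= leey andbT; apply: nneseries_ge0 => k _ _.
    by rewrite lee_fin mulr_ge0.
  move=> /(lee_wpmul2l (w0 x : (0 <= (w x)%:E)%E)).
  rewrite -EFinM mulrC muleCA => /le_trans; apply.
  apply: lee_wpmul2l; first by rewrite lee_fin powR_ge0.
  rewrite -nneseriesZl => [|k _]; last by rewrite lee_fin mulr_ge0 ?powR_ge0.
  apply: lee_nneseries => [k _ _|k _].
    by rewrite -EFinM lee_fin !mulr_ge0 ?powR_ge0.
  by rewrite -!EFinM lee_fin mulrC mulrA.
rewrite ge0_integralZl//; last by rewrite lee_fin powR_ge0.
rewrite integral_nneseries//; last by move=> k x _; rewrite mule_ge0.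
apply: (@le_trans _ _ ((L `^ e)%:E * (\sum_(k <oo) (K%:E * (`|l k| `^ pbar p)%:E)))%E).
  apply: lee_wpmul2l; first by rewrite lee_fin powR_ge0.
  apply: lee_nneseries => [k _ _|k _].
    by apply: integral_ge0 => x _; rewrite mule_ge0.
  rewrite ge0_integralZl//; last exact: mgp.
  by rewrite muleC lee_wpmul2r.
rewrite nneseriesZl// LE muleCA -EFinM poweR_EFin.
rewrite -!EFinM lee_fin; apply: ler_wpM2l => //.
have e1 : 1 + e = p / pbar p by rewrite /e subrKC.
rewrite mulrC -[X in X * _](powRr1 L0) -powRD e1//.
by rewrite gt_eqF// divr_gt0.
Qed.

End superposition.

Unset Implicit Arguments.

Theorem theorem4p3 (R : realType) (n : nat) (s p alpha : R)
    (H : (n.-tuple R -> R) -> (n.-tuple R -> R)) :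
  (0 < n)%N ->
  1 < s ->
  0 < p -> p < s ->
  - (n%:R * (1 - p / s)) < alpha -> alpha < n%:R * (p - 1) ->
  alpha <= 0 ->
  measurable_valued (opdom p s%:E alpha) H ->
  sublinear (opdom p s%:E alpha) H ->
  bounded_on_Lp s%:E H ->
  size_condition (opdom p s%:E alpha) H ->
  countably_sublinear p s%:E alpha H ->
  type_BL_L p s%:E alpha H.
Proof.
move=> n0 s1 p0 ps a1 a2 a3 mH _ bH sH cH.
have s0 : 0 < s by exact: lt_trans s1.
have [K K0 HK] := block_image_bound n0 s1 p0 ps a1 a2 a3 mH bH sH.
exists (K `^ p^-1) => f BLf.
rewrite -ereal_inf_pZl ?powR_gt0//.
apply/ereal_infP => _ [_ [lam [a [dec ->]]] <-].
have [_ blocka lamoo _] := dec.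
rewrite -poweR_EFin /weighted_Lnorm.
set L := (\sum_(k <oo) _)%E.
have L0 : (0 <= L)%E.
  by apply: nneseries_ge0 => k _ _; rewrite lee_fin powR_ge0.
rewrite (_ : (L `^ (pbar p)^-1 = (L `^ (p / pbar p)) `^ p^-1)%E); last first.
  by rewrite -poweRrM mulrAC mulfV ?mul1r// gt_eqF.
rewrite -poweRM ?lee_fin ?(ltW K0) ?poweR_ge0//.
apply: gt0_ler_poweR; first by rewrite invr_ge0 ltW.
- rewrite in_itv/= leey andbT; apply: integral_ge0 => x _.
  by rewrite lee_fin mulr_ge0 ?powR_ge0.
- by rewrite in_itv/= leey andbT mule_ge0 ?poweR_ge0// lee_fin ltW.
apply: (superposition_bound (g := fun k => H (a k)) (l := lam)) => //.
- exact: ltW.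
- exact: measurable_weight.
- by move=> x; exact: powR_ge0.
- exact: (mH _ (or_intror BLf)).
- by move=> k; exact: (mH _ (or_introl (block_Lfun s0 (blocka k)))).
- exact: (cH _ _ _ dec).
- by move=> k; exact: HK.
Qed.
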